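(* (1) Let $f$ be a graph invariant with parameters $\alpha,\beta,\gamma,\delta,\varepsilon$ that is proper and well-defined by the conditions (a)–(d) below. Then $\alpha=1$, $\delta=1$ and $\varepsilon=1+\beta+\gamma$. (2) There is a unique proper graph polynomial $U(G;\beta,\gamma)$ that is well-defined by conditions (a)–(d), and it satisfies $Q(G;x,y)=U(G;x(y-1),x)$ and $U(G;\beta,\gamma)=Q\!\left(G;\gamma,\tfrac{\beta}{\gamma}+1\right)$. The conditions are: (a) (multiplicativity) if $G$ is the disjoint union of $G_1$ and $G_2$ then $f(G)=f(G_1)f(G_2)$; (b) (recurrence) for every graph $G$ and every vertex $v$ of $G$, $f(G)=\alpha f(G-v)+\beta f(G-N[v])+\gamma f(G/v)$; (c) $f$ of the null graph $(\emptyset,\emptyset)$ equals $\delta$; (d) $f(E_1)=\varepsilon$, where $E_1$ is the graph with one vertex and no edges.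
   Context: All graphs are finite, simple and undirected. For a graph $G=(V,E)$ and $X\subseteq V$, $G[X]$ is the induced subgraph and $k(H)$ the number of connected components of $H$ (the null graph has $k=0$). The subgraph component polynomial is $Q(G;x,y)=\sum_{X\subseteq V}x^{|X|}y^{k(G[X])}$. For $v\in V$: $G-v$ removes $v$ and its incident edges; $N[v]$ is the closed neighbourhood of $v$ and $G-N[v]$ removes all its vertices; $G/v$ removes $v$ and inserts edges between all pairs of non-adjacent neighbours of $v$. The parameters $\alpha,\beta,\gamma,\delta,\varepsilon$ are taken from a field of characteristic zero (or a ring). The invariant $f$ is ''well-defined by (a)–(d)'' if the value obtained for every graph by applying (a)–(d) does not depend on the order in which these steps (in particular, the choice of vertex $v$ in (b)) are applied. A graph invariant $f$ is proper if there exist two graphs $G_1,G_2$ with the same number of vertices such that $f(G_1)\neq f(G_2)$.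
   Formalization: The parameters are taken from an integral domain of characteristic zero (including every field of characteristic zero) instead of an arbitrary ring; over rings with zero divisors, such as a product of two fields, the claim fails. *)

(* Defs.v *)
From HB Require Import structures.
From mathcomp Require Import mpoly.
From mathcomp Require Import all_boot all_order all_algebra.

Set Implicit Arguments.
Unset Strict Implicit.
Unset Printing Implicit Defensive.

Import GRing.Theory.
Local Open Scope ring_scope.

Record graph : Type := Graph {
  vertex :> finType;
  adj : rel vertex;
  adj_sym : symmetric adj;
  adj_irr : irreflexive adj
}.

Definition graph_iso (G H : graph) : Prop :=
  exists2 phi : G -> H, bijective phi
    & forall x y : G, adj (phi x) (phi y) = adj x y.

Section Constructions.

Definition null_adj : rel void := fun _ _ => false.
Lemma null_adj_sym : symmetric null_adj. Proof. by []. Qed.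
Lemma null_adj_irr : irreflexive null_adj. Proof. by []. Qed.
Definition null_graph : graph := Graph null_adj_sym null_adj_irr.

Definition single_adj : rel unit := fun _ _ => false.
Lemma single_adj_sym : symmetric single_adj. Proof. by []. Qed.
Lemma single_adj_irr : irreflexive single_adj. Proof. by []. Qed.
Definition single_vertex : graph := Graph single_adj_sym single_adj_irr.

Definition union_adj (G1 G2 : graph) : rel (G1 + G2)%type :=
  fun u v => match u, v with
             | inl x, inl y => adj x y
             | inr x, inr y => adj x y
             | _, _ => false
             end.
Lemma union_adj_sym (G1 G2 : graph) : symmetric (@union_adj G1 G2).
Proof. by move=> [x|x] [y|y] //=; rewrite adj_sym. Qed.
Lemma union_adj_irr (G1 G2 : graph) : irreflexive (@union_adj G1 G2).
Proof. by move=> [x|x] /=; rewrite adj_irr. Qed.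
Definition disjoint_union (G1 G2 : graph) : graph :=
  Graph (@union_adj_sym G1 G2) (@union_adj_irr G1 G2).

Definition induced_adj (G : graph) (X : {set G}) : rel {x : G | x \in X} :=
  fun u v => adj (val u) (val v).
Lemma induced_adj_sym (G : graph) (X : {set G}) : symmetric (@induced_adj G X).
Proof. by move=> u v; apply: adj_sym. Qed.
Lemma induced_adj_irr (G : graph) (X : {set G}) : irreflexive (@induced_adj G X).
Proof. by move=> u; apply: adj_irr. Qed.
Definition induced (G : graph) (X : {set G}) : graph :=
  Graph (@induced_adj_sym G X) (@induced_adj_irr G X).

Definition closed_nbh (G : graph) (v : G) : {set G} :=
  [set w | (w == v) || adj v w].

Definition del_vertex (G : graph) (v : G) : graph := induced [set~ v].

Definition del_closed_nbh (G : graph) (v : G) : graph :=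
  induced (~: closed_nbh v).

(* G with the neighbours of v made pairwise adjacent; v itself is kept. *)
Definition saturate_adj (G : graph) (v : G) : rel G :=
  fun x y => adj x y || [&& x != y, adj v x & adj v y].
Lemma saturate_adj_sym (G : graph) (v : G) : symmetric (saturate_adj v).
Proof.
by move=> x y; rewrite /saturate_adj adj_sym eq_sym [adj v x && _]andbC.
Qed.
Lemma saturate_adj_irr (G : graph) (v : G) : irreflexive (saturate_adj v).
Proof. by move=> x; rewrite /saturate_adj adj_irr eqxx. Qed.
Definition saturate (G : graph) (v : G) : graph :=
  Graph (saturate_adj_sym v) (saturate_adj_irr v).

Definition contract_vertex (G : graph) (v : G) : graph :=
  @induced (saturate v) [set~ v].

Definition components (G : graph) : nat := n_comp (@adj G) predT.

End Constructions.

(* Q(G; x, y), with x and y elements of an arbitrary commutative ring; the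
   polynomial itself is its value at the indeterminates. *)
Definition Q (S : comNzRingType) (G : graph) (x y : S) : S :=
  \sum_(X : {set G}) x ^+ #|X| * y ^+ components (induced X).

Definition graph_invariant (S : Type) (f : graph -> S) : Prop :=
  forall G H : graph, graph_iso G H -> f G = f H.

Definition proper_invariant (S : Type) (f : graph -> S) : Prop :=
  exists G1 G2 : graph, #|G1| = #|G2| /\ f G1 <> f G2.

Record satisfies_conditions (S : comNzRingType) (alpha beta gamma delta eps : S)
    (f : graph -> S) : Prop := SatisfiesConditions {
  cond_a : forall G G1 G2 : graph,
    graph_iso G (disjoint_union G1 G2) -> f G = f G1 * f G2;
  cond_b : forall (G : graph) (v : G),
    f G = alpha * f (del_vertex v) + beta * f (del_closed_nbh v)
          + gamma * f (contract_vertex v);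
  cond_c : f null_graph = delta;
  cond_d : f single_vertex = eps
}.

(* [obtains ... G r]: some way of applying the steps (a)-(d) to G, with any
   choice of decompositions and of vertices, yields the value r. Graphs are
   considered up to isomorphism. *)
Inductive obtains (S : comNzRingType) (alpha beta gamma delta eps : S) :
    graph -> S -> Prop :=
| obtains_iso (G H : graph) (r : S) :
    graph_iso G H -> obtains alpha beta gamma delta eps H r ->
    obtains alpha beta gamma delta eps G r
| obtains_a (G1 G2 : graph) (r1 r2 : S) :
    obtains alpha beta gamma delta eps G1 r1 ->
    obtains alpha beta gamma delta eps G2 r2 ->
    obtains alpha beta gamma delta eps (disjoint_union G1 G2) (r1 * r2)
| obtains_b (G : graph) (v : G) (r1 r2 r3 : S) :
    obtains alpha beta gamma delta eps (del_vertex v) r1 ->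
    obtains alpha beta gamma delta eps (del_closed_nbh v) r2 ->
    obtains alpha beta gamma delta eps (contract_vertex v) r3 ->
    obtains alpha beta gamma delta eps G
      (alpha * r1 + beta * r2 + gamma * r3)
| obtains_c : obtains alpha beta gamma delta eps null_graph delta
| obtains_d : obtains alpha beta gamma delta eps single_vertex eps.

(* f satisfies (a)-(d), and f G is the one value that applying (a)-(d) to G
   can produce, in whatever order the steps are taken. *)
Definition well_defined_by (S : comNzRingType) (alpha beta gamma delta eps : S)
    (f : graph -> S) : Prop :=
  satisfies_conditions alpha beta gamma delta eps f /\
  forall (G : graph) (r : S),
    obtains alpha beta gamma delta eps G r <-> r = f G.

(* The two indeterminates of R[X_0, X_1]. *)
Definition var0 (R : comNzRingType) : {mpoly R[2]} := 'X_(ord0 : 'I_2).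
Definition var1 (R : comNzRingType) : {mpoly R[2]} := 'X_(ord_max : 'I_2).
Arguments var0 R : clear implicits.
Arguments var1 R : clear implicits.

(* Main.v *)
Require Import Defs.
From HB Require Import structures.
From mathcomp Require Import mpoly.
From mathcomp Require Import all_boot all_order all_algebra.
From mathcomp Require Import ring.

Set Implicit Arguments.
Unset Strict Implicit.
Unset Printing Implicit Defensive.

Import GRing.Theory.
Local Open Scope ring_scope.

(* The null graph and multiplicativity force delta = 1, a single vertex forces
   eps = alpha + beta + gamma, and evaluating the path on three vertices by
   removing first its middle vertex or first an end vertex gives
   beta (eps - 1) (alpha - 1) = 0. If beta = 0 or eps = 1, the recurrence makes
   f a function of the number of vertices, so properness leaves alpha = 1.

   Conversely U(G) = \sum_X gamma^(|X| - k) (beta + gamma)^k, k = k(G[X]), is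
   Q(G; gamma, beta/gamma + 1) with denominators cleared. For the recurrence at
   v, write the subsets containing v as v + Y: if Y misses N(v), then v is a new
   component of weight beta + gamma, accounting for G - N[v] and G/v; otherwise
   v adds no component to (G/v)[Y] and contributes a factor gamma. *)

(** * Isomorphisms and induced subgraphs *)

Lemma graph_iso_refl (G : graph) : graph_iso G G.
Proof. by exists id => //; exists id. Qed.

(** An injection into a set that is no larger is bijective, so no inverse between subtypes has to be
    written down. *)
Lemma graph_iso_inj (G H : graph) (phi : G -> H) :
  injective phi -> (#|H| <= #|G|)%N ->
  (forall x y, adj (phi x) (phi y) = adj x y) -> graph_iso G H.
Proof. by move=> phi_inj le_HG phiE; exists phi => //; apply: inj_card_bij. Qed.

Lemma card_induced (G : graph) (X : {set G}) : #|induced X| = #|X|.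
Proof. exact: card_sig. Qed.

Lemma graph_iso_imset (G H : graph) (phi : H -> G) (X : {set H}) :
  injective phi -> (forall x y, adj (phi x) (phi y) = adj x y) ->
  graph_iso (induced X) (induced (phi @: X)).
Proof.
move=> phi_inj phiE.
apply: (@graph_iso_inj (induced X) (induced (phi @: X)) (fun u =>
  exist (fun x => x \in phi @: X) (phi (val u)) (imset_f phi (valP u)))).
- by move=> u w /(congr1 val) /= /phi_inj /val_inj.
- by rewrite !card_induced card_imset.
- by move=> u w; rewrite /= /induced_adj /= phiE.
Qed.

(** * Counting connected components *)

Section Components.

Lemma connect_adj_sym (G : graph) : connect_sym (@adj G).
Proof. by apply: sym_connect_sym; apply: adj_sym. Qed.

(* [g] and [h] behave like mutually inverse homotopy equivalences, and hence
   induce inverse bijections between the components. *)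
Lemma components_equiv (G H : graph) (g : G -> H) (h : H -> G) :
  (forall x y, adj x y -> connect (@adj H) (g x) (g y)) ->
  (forall x y, adj x y -> connect (@adj G) (h x) (h y)) ->
  (forall x, connect (@adj G) x (h (g x))) ->
  (forall x, connect (@adj H) x (g (h x))) ->
  components G = components H.
Proof.
move=> gP hP hg gh.
have clT : closed (@adj G) predT by [].
apply: (adjunction_n_comp h (@connect_adj_sym G) (@connect_adj_sym H) clT).
apply: (intro_adjunction (@connect_adj_sym H) clT (fun x _ => g x)).
- by move=> x _; split=> // y _; apply: gP.
- by move=> x _; split=> // y; apply: hP.
Qed.

Lemma components_iso (G H : graph) : graph_iso G H -> components G = components H.
Proof.
case=> phi [psi phiK psiK] phiE; apply: (@components_equiv G H phi psi).
- by move=> x y xy; apply: connect1; rewrite phiE.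
- by move=> x y xy; apply: connect1; rewrite -phiE !psiK.
- by move=> x; rewrite phiK.
- by move=> x; rewrite psiK.
Qed.

Lemma components_le (G : graph) : (components G <= #|G|)%N.
Proof. exact: max_card. Qed.

Lemma components_single : components single_vertex = 1%N.
Proof.
rewrite /components -(n_comp_connect (@connect_adj_sym single_vertex) tt).
by apply: eq_n_comp_r => -[]; apply/esym/connect0.
Qed.

(** No edge joins the two summands, so the count splits over the left one and its complement; an
    adjunction matches each half with its own graph. *)
Lemma components_disjoint_union (G1 G2 : graph) :
  components (disjoint_union G1 G2) = (components G1 + components G2)%N.
Proof.
pose isl (u : disjoint_union G1 G2) := if u is inl _ then true else false.
have symU := @connect_adj_sym (disjoint_union G1 G2).
have cl : closed (@adj (disjoint_union G1 G2)) isl by move=> [x|x] [y|y].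
have clC : closed (@adj (disjoint_union G1 G2)) [predC isl].
  by move=> [x|x] [y|y].
rewrite /components (n_compC isl); congr (_ + _)%N.
- rewrite (adjunction_n_comp inl symU (@connect_adj_sym G1) cl).
    exact: eq_n_comp_r.
  pose h' x : x \in isl -> G1 := match x with inl y => fun _ => y
    | inr y => fun F => False_rect G1 (notF F) end.
  apply: (intro_adjunction (@connect_adj_sym G1) cl h') => [[x|x] //= ? | x ?] /=.
  + split=> [|[y|y] // ?]; first exact: connect0.
    by move=> xy; apply: connect1.
  + by split=> [|y xy]; [apply: connect0 | apply: connect1].
- rewrite (adjunction_n_comp inr symU (@connect_adj_sym G2) clC).
    exact: eq_n_comp_r.
  pose h' x : x \in [predC isl] -> G2 := match x with inr y => fun _ => y
    | inl y => fun F => False_rect G2 (notF F) end.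
  apply: (intro_adjunction (@connect_adj_sym G2) clC h') => [[x|x] //= ? | x ?] /=.
  + split=> [|[y|y] // ?]; first exact: connect0.
    by move=> xy; apply: connect1.
  + by split=> [|y xy]; [apply: connect0 | apply: connect1].
Qed.

Lemma graph_iso_induced_isolated (G : graph) (v : G) (Y : {set G}) :
  v \notin Y -> (forall w, w \in Y -> ~~ adj v w) ->
  graph_iso (disjoint_union single_vertex (induced Y)) (induced (v |: Y)).
Proof.
move=> vY nvY.
apply: (@graph_iso_inj (disjoint_union single_vertex (induced Y))
  (induced (v |: Y)) (fun u =>
  match u with
  | inl _ => exist (fun x => x \in v |: Y) v (setU11 v Y)
  | inr w => exist (fun x => x \in v |: Y) (val w) (setU1r v (valP w))
  end)).
- move=> [[]|[x xY]] [[]|[y yY]] //= /(congr1 val) /= e.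
  + by rewrite e yY in vY.
  + by rewrite -e xY in vY.
  + by congr inr; apply: val_inj.
- by rewrite card_sum card_unit !card_induced cardsU1 vY.
- move=> [[]|[x xY]] [[]|[y yY]]; rewrite /= /induced_adj /= ?adj_irr //.
  + exact/negbTE/nvY.
  + by rewrite adj_sym; apply/negbTE/nvY.
Qed.

(* Walks through [v] may bypass it: the neighbours of [v] are pairwise adjacent
   after saturation, so [v] can be retracted onto any of them. *)
Lemma components_saturate (G : graph) (v w : G) (Y : {set G}) :
  v \notin Y -> w \in Y -> adj v w ->
  components (induced (v |: Y)) = components (@induced (saturate v) Y).
Proof.
move=> vY wY vw.
pose H := @induced (saturate v) Y.
pose inH y (yY : y \in Y) : H := exist (fun y => y \in Y) y yY.
pose w' : H := inH w wY.
(* The default of [insubd] matters: [v] is the only vertex outside [Y], and it is sent to [w]. *)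
pose g (u : induced (v |: Y)) : H := insubd w' (val u).
pose h (y : H) : induced (v |: Y) :=
  exist (fun x => x \in v |: Y) (val y) (setU1r v (valP y)).
have neq_v y : y \in Y -> y == v = false.
  by move=> yY; apply/negbTE; apply: contraNneq vY => <-.
have gY (y : G) (yY : y \in Y) (yvY : y \in v |: Y) :
    g (exist (fun x => x \in v |: Y) y yvY) = inH y yY.
  by apply: val_inj; rewrite /g val_insubd /= yY.
have gv (vvY : v \in v |: Y) : g (exist (fun x => x \in v |: Y) v vvY) = w'.
  by apply: val_inj; rewrite /g val_insubd /= (negbTE vY).
(* After saturation a neighbour of [v] in [Y] is [w] itself or adjacent to [w]. *)
have nbh_w y (yY : y \in Y) : adj v y -> connect (@adj H) w' (inH y yY).
  move=> vy; have [e|ne] := eqVneq w y.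
    by rewrite (_ : inH y yY = w') ?connect0 //; apply: val_inj.
  by apply: connect1; rewrite /= /induced_adj /= /saturate_adj ne vw vy orbT.
have splitvY x : x \in v |: Y -> x = v \/ x \in Y.
  by rewrite !inE => /orP[/eqP|]; [left | right].
apply: (@components_equiv _ _ g h).
- move=> [x xvY] [y yvY] xy; rewrite /= /induced_adj /= in xy.
  case: (splitvY x xvY) => [xv|xY]; case: (splitvY y yvY) => [yv|yY]; subst.
  + by rewrite adj_irr in xy.
  + by rewrite gv (gY _ yY); apply: nbh_w.
  + rewrite gv (gY _ xY) connect_adj_sym; apply: nbh_w.
    by rewrite adj_sym.
  + rewrite !gY; apply: connect1.
    by rewrite /= /induced_adj /= /saturate_adj xy.
- move=> [x xY] [y yY] xy; rewrite /= /induced_adj /= /saturate_adj in xy.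
  case/orP: xy => [xy|/and3P[_ vx vy]]; first exact: connect1.
  have v' : v \in v |: Y by exact: setU11.
  (* An edge created by saturation is replaced by the walk [x], [v], [y]. *)
  by apply: (@connect_trans _ _ (exist (fun x => x \in v |: Y) v v'));
    apply: connect1; rewrite /= /induced_adj /= // adj_sym.
- move=> [x xvY]; case: (splitvY x xvY) => [xv|xY]; subst.
    by rewrite gv; apply: connect1.
  by rewrite gY (_ : h _ = exist (fun x => x \in v |: Y) x xvY) ?connect0 //;
    apply: val_inj.
- by move=> [x xY]; rewrite /h /= gY connect0.
Qed.

End Components.

(** * The weighted subgraph sum and its recurrence *)

Section SubgraphSum.

Variables (S : comNzRingType) (b c : S).

(** The subtraction is never truncated, because components do not outnumber vertices. *)
Definition weight (G : graph) : S :=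
  c ^+ (#|G| - components G) * (b + c) ^+ components G.

Definition Upoly (G : graph) : S := \sum_(X : {set G}) weight (induced X).

Lemma weight_iso (G H : graph) : graph_iso G H -> weight G = weight H.
Proof.
move=> GH; rewrite /weight (components_iso GH).
by case: GH => phi /bij_eq_card ->.
Qed.

Lemma weight_disjoint_union (G1 G2 : graph) :
  weight (disjoint_union G1 G2) = weight G1 * weight G2.
Proof.
rewrite /weight components_disjoint_union card_sum.
have -> : (#|G1| + #|G2| - (components G1 + components G2) =
           #|G1| - components G1 + (#|G2| - components G2))%N.
  by rewrite addnBA ?components_le // addnBAC ?components_le // subnDA.
by rewrite !exprD mulrACA.
Qed.

Lemma weight_single : weight single_vertex = b + c.
Proof. by rewrite /weight components_single card_unit subnn mul1r. Qed.

Lemma weight_induced_isolated (G : graph) (v : G) (Y : {set G}) :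
  v \notin Y -> (forall w, w \in Y -> ~~ adj v w) ->
  weight (induced (v |: Y)) = (b + c) * weight (induced Y).
Proof.
move=> vY nvY.
by rewrite -(weight_iso (graph_iso_induced_isolated vY nvY))
           weight_disjoint_union weight_single.
Qed.

(** Both graphs have equally many components, so the extra vertex [v] raises only the exponent of
    [c]. *)
Lemma weight_saturate (G : graph) (v w : G) (Y : {set G}) :
  v \notin Y -> w \in Y -> adj v w ->
  weight (induced (v |: Y)) = c * weight (@induced (saturate v) Y).
Proof.
move=> vY wY vw; rewrite /weight (components_saturate vY wY vw).
rewrite !card_induced cardsU1 vY add1n subSn ?exprS ?mulrA //.
by rewrite -(card_induced (G := saturate v)) components_le.
Qed.

(** Saturation only joins neighbours of [v], and [Y] contains none. *)
Lemma weight_saturate_isolated (G : graph) (v : G) (Y : {set G}) :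
  (forall w, w \in Y -> ~~ adj v w) ->
  weight (@induced (saturate v) Y) = weight (induced Y).
Proof.
move=> nvY; apply: weight_iso; exists id; first by exists id.
move=> [x xY] [y yY]; rewrite /= /induced_adj /= /saturate_adj.
by rewrite (negbTE (nvY _ xY)) andbF orbF.
Qed.

(** Subsets of [H] correspond to subsets of the image, with isomorphic induced subgraphs. This
    serves both isomorphism invariance and, with [phi] the inclusion of a subtype, induced
    subgraphs. *)
Lemma Upoly_embedding (G H : graph) (phi : H -> G) :
  injective phi -> (forall x y, adj (phi x) (phi y) = adj x y) ->
  Upoly H = \sum_(X : {set G} | X \subset phi @: H) weight (induced X).
Proof.
move=> phi_inj phiE; pose im (X : {set H}) := phi @: X.
have preK (X : {set H}) : phi @^-1: im X = X.
  by apply/setP=> x; rewrite inE mem_imset.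
rewrite (reindex_onto im (fun X : {set G} => phi @^-1: X)) => [|X sX] /=; last first.
  apply/setP=> y; apply/imsetP/idP => [[x] | yX]; first by rewrite inE => ? ->.
  by have /imsetP[x _ e] := subsetP sX y yX; exists x; rewrite // inE -e.
apply: eq_big => [X|X _]; last exact/weight_iso/graph_iso_imset.
by rewrite preK eqxx andbT; apply/esym/imsetS/subsetP.
Qed.

Lemma Upoly_iso (G H : graph) : graph_iso G H -> Upoly G = Upoly H.
Proof.
case=> phi phi_bij phiE; rewrite (Upoly_embedding (bij_inj phi_bij) phiE).
apply: eq_bigl => X; apply/subsetP=> y _.
by case: phi_bij => psi _ psiK; rewrite -(psiK y) imset_f.
Qed.

Lemma Upoly_induced (G : graph) (A : {set G}) :
  Upoly (induced A) = \sum_(X : {set G} | X \subset A) weight (induced X).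
Proof.
rewrite (@Upoly_embedding G (induced A) val) => //; last exact: val_inj.
apply: eq_bigl => X; apply: eq_subset_r => x.
apply/imsetP/idP => [[u _ ->]|xA]; first exact: valP.
by exists (exist (fun x => x \in A) x xA).
Qed.

(** A subset of the union is a pair of subsets, and the weight is multiplicative. *)
Lemma Upoly_disjoint_union (G1 G2 : graph) :
  Upoly (disjoint_union G1 G2) = Upoly G1 * Upoly G2.
Proof.
pose U := disjoint_union G1 G2.
pose join (p : {set G1} * {set G2}) : {set U} :=
  [set u : U | match u with inl x => x \in p.1 | inr y => y \in p.2 end].
pose split (X : {set U}) : {set G1} * {set G2} :=
  ([set x | (inl x : U) \in X], [set y | (inr y : U) \in X]).
have joinK : cancel join split.
  by move=> [X Y]; congr (_, _); apply/setP=> x; rewrite !inE.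
have splitK : cancel split join.
  by move=> X; apply/setP=> -[x|x]; rewrite !inE.
rewrite /Upoly big_distrlr pair_big /= (reindex join) /=; last first.
  by exists split => p _.
apply: eq_bigr => -[X Y] _; rewrite -weight_disjoint_union.
apply/esym/weight_iso.
have jl x : x \in X -> (inl x : U) \in join (X, Y) by rewrite inE.
have jr x : x \in Y -> (inr x : U) \in join (X, Y) by rewrite inE.
apply: (@graph_iso_inj (disjoint_union (induced X) (induced Y))
  (induced (join (X, Y))) (fun u =>
  match u with
  | inl x => exist (fun u => u \in join (X, Y)) (inl (val x)) (jl _ (valP x))
  | inr x => exist (fun u => u \in join (X, Y)) (inr (val x)) (jr _ (valP x))
  end)).
- by move=> [[x xX]|[x xY]] [[y yX]|[y yY]] //= /(congr1 val) /= [e];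
    congr (_ _); apply: val_inj.
(* The map being injective, an upper bound on the size of [join (X, Y)] is enough. *)
- rewrite card_sum !card_induced.
  have -> : join (X, Y) = inl @: X :|: inr @: Y.
    apply/setP=> -[x|x]; rewrite !inE.
      rewrite mem_imset; last by move=> ? ? [].
      by case: imsetP => [[]//|_]; rewrite orbF.
    rewrite mem_imset; last by move=> ? ? [].
    by case: imsetP => [[]//|_]; rewrite orFb.
  apply: leq_trans (leq_card_setU _ _) _.
  by apply: leq_add; apply: leq_imset_card.
- by move=> [[x xX]|[x xY]] [[y yX]|[y yY]].
Qed.

Lemma Upoly_null : Upoly null_graph = 1.
Proof.
have set0E (X : {set null_graph}) : X = set0 by apply/setP=> -[].
rewrite /Upoly (big_pred1 set0) => [|X]; last by rewrite [X]set0E /= eqxx.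
rewrite /weight card_induced cards0 sub0n mul1r.
by have := components_le (induced (set0 : {set null_graph}));
  rewrite card_induced cards0 leqn0 => /eqP ->.
Qed.

Lemma Upoly_recurrence (G : graph) (v : G) :
  Upoly G = Upoly (del_vertex v) + b * Upoly (del_closed_nbh v)
            + c * Upoly (contract_vertex v).
Proof.
have subv (X : {set G}) : (X \subset [set~ v]) = (v \notin X).
  by rewrite subsetC sub1set inE.
(* All three terms are indexed by the sets [Y] avoiding [v]; in this one the sets that meet the
   neighbourhood contribute [0]. *)
have -> : Upoly (del_closed_nbh v) = \sum_(Y : {set G} | v \notin Y)
     if Y \subset ~: closed_nbh v then weight (induced Y) else 0.
  rewrite Upoly_induced -big_mkcondr; apply: eq_bigl => X.
  apply/idP/andP=> [sX|[]//]; split=> //.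
  apply: contraTN sX => vX; apply/negP=> /subsetP/(_ _ vX).
  by rewrite !inE eqxx.
have -> : Upoly (contract_vertex v) =
    \sum_(Y : {set G} | v \notin Y) weight (@induced (saturate v) Y).
  by rewrite (@Upoly_induced (saturate v)); apply: eq_bigl.
have -> : Upoly (del_vertex v) =
    \sum_(Y : {set G} | v \notin Y) weight (induced Y).
  by rewrite Upoly_induced; apply: eq_bigl.
(* The sets avoiding [v] give the first term; those containing [v] are then indexed by
   [Y = X :\ v]. *)
rewrite [LHS](bigID (fun X : {set G} => v \notin X)) /= -addrA; congr (_ + _).
rewrite [LHS](reindex_onto (fun Y => v |: Y) (fun X => X :\ v)) => [|X];
  last by rewrite negbK => /setD1K.
rewrite !mulr_sumr -big_split /=; apply: eq_big => [Y|Y].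
  rewrite setU11 /=; apply/eqP/idP => [<-|vY]; last exact: setU1K.
  by rewrite !inE eqxx.
case/andP=> _ /eqP eY; have vY : v \notin Y by rewrite -eY !inE eqxx.
case: ifP => [sY|/negbT nsY].
  have nvY w : w \in Y -> ~~ adj v w.
    by move=> /(subsetP sY); rewrite !inE negb_or => /andP[].
  by rewrite weight_induced_isolated // weight_saturate_isolated // mulrDl.
(* Here [Y] meets the closed neighbourhood but omits [v], so it contains a neighbour [w]. *)
rewrite mulr0 add0r; have /subsetPn[w wY] := nsY.
rewrite !inE negbK => /orP[/eqP e|vw]; first by rewrite -e wY in vY.
exact: weight_saturate vw.
Qed.

End SubgraphSum.

(** * Consequences of conditions (a)-(d) *)

Section Conditions.

Lemma card_del_vertex (G : graph) (v : G) : (#|del_vertex v|).+1 = #|G|.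
Proof. by rewrite card_induced cardsC1 prednK //; apply/card_gt0P; exists v. Qed.

Lemma card_contract_vertex (G : graph) (v : G) : (#|contract_vertex v|).+1 = #|G|.
Proof. exact: (@card_del_vertex (saturate v)). Qed.

Lemma card_del_closed_nbh (G : graph) (v : G) :
  (#|del_closed_nbh v| + #|closed_nbh v|)%N = #|G|.
Proof. by rewrite card_induced addnC cardsC. Qed.

Lemma card_single_deletions (v := tt : single_vertex) :
  [/\ #|del_vertex v| = 0%N, #|del_closed_nbh v| = 0%N
    & #|contract_vertex v| = 0%N].
Proof.
split; try by apply: succn_inj; rewrite ?card_del_vertex ?card_contract_vertex card_unit.
have := card_del_closed_nbh v.
rewrite (_ : closed_nbh _ = [set: single_vertex]); last first.
  by apply/setP=> -[]; rewrite !inE.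
by rewrite cardsT card_unit => /(congr1 predn); rewrite addn1.
Qed.

Lemma graph_iso_null (G : graph) : #|G| = 0%N -> graph_iso G null_graph.
Proof.
move=> G0; have noG (x : G) : False by have := card0_eq G0 x.
apply: (@graph_iso_inj _ null_graph (fun x => match noG x with end)).
- by move=> x; case: (noG x).
- by rewrite card_void.
- by move=> x; case: (noG x).
Qed.

Lemma graph_iso_single (G : graph) : #|G| = 1%N -> graph_iso G single_vertex.
Proof.
move=> G1; have sG (x y : G) : x = y.
  by have /fintype_le1P := eq_leq G1; apply.
apply: (@graph_iso_inj _ single_vertex (fun _ => tt)).
- by move=> x y _.
- by rewrite card_unit G1.
- by move=> x y; rewrite (sG x y) [RHS]adj_irr.
Qed.

Lemma graph_iso_union_null (G : graph) : graph_iso G (disjoint_union G null_graph).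
Proof.
apply: (@graph_iso_inj G (disjoint_union G null_graph) inl) => //.
- by move=> x y [].
- by rewrite card_sum card_void addn0.
Qed.

(** All three graphs on the right of (b) have fewer vertices, so strong induction on the vertex
    count follows the recurrence. *)
Lemma vertex_ind (P : graph -> Prop) :
  (forall G : graph, #|G| = 0%N -> P G) ->
  (forall (G : graph) (v : G), P (del_vertex v) -> P (del_closed_nbh v) ->
     P (contract_vertex v) -> P G) ->
  forall G, P G.
Proof.
move=> P0 Pv G; have [n] := ubnP #|G|; elim: n G => // n IH G ltG.
have [G0|/card_gt0P[v _]] := posnP #|G|; first exact: P0.
apply: (Pv G v); apply: IH; rewrite -ltnS; apply: leq_trans ltG.
- by rewrite card_del_vertex.
- rewrite -(card_del_closed_nbh v) -[X in (X <= _)%N]addn1 leq_add2l.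
  by apply/card_gt0P; exists v; rewrite inE eqxx.
- by rewrite card_contract_vertex.
Qed.

Variables (S : comNzRingType) (alpha beta gamma delta eps : S) (f : graph -> S).
Hypothesis f_inv : graph_invariant f.
Hypothesis fP : satisfies_conditions alpha beta gamma delta eps f.

Lemma cond_card0 (G : graph) : #|G| = 0%N -> f G = delta.
Proof. by move=> /graph_iso_null/f_inv ->; apply: cond_c fP. Qed.

Lemma cond_card1 (G : graph) : #|G| = 1%N -> f G = eps.
Proof. by move=> /graph_iso_single/f_inv ->; apply: cond_d fP. Qed.

Lemma recurrence_unique (F : graph -> S) :
  (forall G : graph, #|G| = 0%N -> F G = delta) ->
  (forall (G : graph) (v : G), F G = alpha * F (del_vertex v)
     + beta * F (del_closed_nbh v) + gamma * F (contract_vertex v)) ->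
  forall G : graph, f G = F G.
Proof.
move=> F0 FP; apply: vertex_ind => [G G0|G v f1 f2 f3].
  by rewrite F0 // cond_card0.
by rewrite (cond_b fP v) (FP G v) f1 f2 f3.
Qed.

(** Each rule of [obtains] is an identity that [f] satisfies, so every derivation yields [f G].
    Conversely, applying (b) until the null graph is reached derives [f G]. *)
Lemma well_defined : well_defined_by alpha beta gamma delta eps f.
Proof.
split=> // G r; split=> [|-> {r}].
  elim=> {G r} [G H r /f_inv -> _ -> //|G1 G2 r1 r2 _ -> _ -> |
    G v r1 r2 r3 _ -> _ -> _ ->||].
  - exact/esym/(cond_a fP)/graph_iso_refl.
  - exact/esym/(cond_b fP).
  - exact/esym/(cond_c fP).
  - exact/esym/(cond_d fP).
move: G; apply: vertex_ind => [G G0|G v f1 f2 f3].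
  rewrite cond_card0 //; apply: obtains_iso (graph_iso_null G0) _.
  exact: obtains_c.
by rewrite (cond_b fP v); apply: obtains_b f1 f2 f3.
Qed.

(** The closed neighbourhood is [[set v]], so all three operations leave one vertex. *)
Lemma cond_edgeless2 (G : graph) : #|G| = 2%N -> (forall x y : G, ~~ adj x y) ->
  f G = (alpha + beta + gamma) * eps.
Proof.
move=> G2 noE; have [v _] : exists v : G, v \in G by apply/card_gt0P; rewrite G2.
have N1 : closed_nbh v = [set v].
  by apply/setP=> x; rewrite !inE (negbTE (noE v x)) orbF.
rewrite (cond_b fP v) !cond_card1 ?mulrDl ?mulrDl //; apply: succn_inj.
- by rewrite card_contract_vertex.
- by have := card_del_closed_nbh v; rewrite N1 cards1 addn1 => ->.
- by rewrite card_del_vertex.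
Qed.

Lemma cond_complete2 (G : graph) :
  #|G| = 2%N -> (forall x y : G, x != y -> adj x y) ->
  f G = alpha * eps + beta * delta + gamma * eps.
Proof.
move=> G2 allE; have [v _] : exists v : G, v \in G by apply/card_gt0P; rewrite G2.
have N1 : closed_nbh v = [set: G].
  by apply/setP=> x; rewrite !inE; case: eqVneq => //= ne; rewrite allE // eq_sym.
rewrite (cond_b fP v).
rewrite [f (del_vertex v)]cond_card1 ?[f (del_closed_nbh v)]cond_card0;
  rewrite ?[f (contract_vertex v)]cond_card1 //.
- by apply: succn_inj; rewrite card_contract_vertex.
- have := card_del_closed_nbh v; rewrite N1 cardsT -[RHS]add0n.
  exact: addIn.
- by apply: succn_inj; rewrite card_del_vertex.
Qed.

End Conditions.

(** * Two evaluations of the path on three vertices *)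

Section SmallGraphs.

Definition edgeless2_adj : rel bool := fun _ _ => false.
Lemma edgeless2_sym : symmetric edgeless2_adj. Proof. by []. Qed.
Lemma edgeless2_irr : irreflexive edgeless2_adj. Proof. by []. Qed.
Definition edgeless2 : graph := Graph edgeless2_sym edgeless2_irr.

Definition complete2_adj : rel bool := fun x y => x != y.
Lemma complete2_sym : symmetric complete2_adj. Proof. by move=> [] []. Qed.
Lemma complete2_irr : irreflexive complete2_adj. Proof. by move=> []. Qed.
Definition complete2 : graph := Graph complete2_sym complete2_irr.

(* The path on three vertices, with middle vertex [None]. *)
Definition path3_adj : rel (option bool) := fun x y => isSome x != isSome y.
Lemma path3_sym : symmetric path3_adj. Proof. by move=> [?|] [?|]. Qed.
Lemma path3_irr : irreflexive path3_adj. Proof. by move=> [?|]. Qed.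
Definition path3 : graph := Graph path3_sym path3_irr.

Variables (S : comNzRingType) (alpha beta gamma delta eps : S) (f : graph -> S).
Hypothesis f_inv : graph_invariant f.
Hypothesis fP : satisfies_conditions alpha beta gamma delta eps f.

(** The value of [f] on the complete graph with two vertices, by [cond_complete2]. *)
Let k2 := alpha * eps + beta * delta + gamma * eps.

Let card_path3 : #|path3| = 3%N.
Proof. by rewrite card_option card_bool. Qed.

(** Deleting the middle leaves two isolated ends, deleting its closed neighbourhood leaves nothing,
    and contracting it joins the ends. *)
Lemma path3_middle :
  f path3 = alpha * ((alpha + beta + gamma) * eps) + beta * delta + gamma * k2.
Proof.
rewrite (cond_b fP (None : path3)); congr (alpha * _ + beta * _ + gamma * _).
- apply: (cond_edgeless2 f_inv fP) => [|[[x|] xN] [[y|] yN] //].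
  + by apply: succn_inj; rewrite card_del_vertex.
  + by have := yN; rewrite !inE.
  + by have := xN; rewrite !inE.
- apply: (cond_card0 f_inv fP).
  have := card_del_closed_nbh (None : path3).
  rewrite (_ : closed_nbh _ = [set: path3]); last first.
    by apply/setP=> -[x|]; rewrite !inE.
  by rewrite cardsT card_path3 => /(congr1 (subn^~ 3)); rewrite /= addnK.
- apply: (cond_complete2 f_inv fP) => [|[[x|] xN] [[y|] yN]].
  + by apply: succn_inj; rewrite card_contract_vertex.
  + by rewrite -val_eqE /= /induced_adj /= /saturate_adj => ->.
  + by have := yN; rewrite !inE.
  + by have := xN; rewrite !inE.
  + by have := xN; rewrite !inE.
Qed.

(** An end has a single neighbour, so contracting it adds no edge and, like deletion, leaves one
    edge; deleting its closed neighbourhood leaves the other end. *)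
Lemma path3_end : f path3 = alpha * k2 + beta * eps + gamma * k2.
Proof.
rewrite (cond_b fP (Some true : path3)).
rewrite (cond_card1 f_inv fP (G := del_closed_nbh _)); last first.
  have := card_del_closed_nbh (Some true : path3).
  rewrite (_ : closed_nbh _ = [set (None : path3); Some true]); last first.
    by apply/setP=> -[[]|]; rewrite !inE.
  by rewrite cards2 card_path3 => /(congr1 (subn^~ 2)); rewrite /= addnK.
congr (alpha * _ + beta * _ + gamma * _); apply: (cond_complete2 f_inv fP).
- by apply: succn_inj; rewrite card_del_vertex.
- by move=> [[[]|] xN] [[[]|] yN] //=; have := xN; have := yN; rewrite !inE.
- by apply: succn_inj; rewrite card_contract_vertex.
- by move=> [[[]|] xN] [[[]|] yN] //=; have := xN; have := yN; rewrite !inE.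
Qed.

End SmallGraphs.

(** * Parameters forced by properness *)

Section ProperInvariant.

Variables (R : idomainType) (alpha beta gamma delta eps : R) (f : graph -> R).
Hypothesis f_inv : graph_invariant f.
Hypothesis f_proper : proper_invariant f.
Hypothesis fP : satisfies_conditions alpha beta gamma delta eps f.

Lemma not_proper_card (F : nat -> R) : ~ (forall G : graph, f G = F #|G|).
Proof. by case: f_proper => G1 [G2 [eG nf]] fE; apply: nf; rewrite !fE eG. Qed.

(** Adding the null graph gives [f G = f G * delta]; in a domain, [delta != 1] would make [f] vanish
    identically. *)
Lemma delta_eq1 : delta = 1.
Proof.
have f_delta (G : graph) : f G = f G * delta.
  by rewrite -(cond_c fP) -(cond_a fP (graph_iso_union_null G)).
have [//|d1] := eqVneq delta 1.
case: (@not_proper_card (fun _ => 0)) => G; apply/eqP.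
have := f_delta G; rewrite -{1}[f G]mulr1 => /eqP; rewrite -subr_eq0 -mulrBr.
by rewrite mulf_eq0 subr_eq0 [1 == _]eq_sym (negbTE d1) orbF.
Qed.

Lemma eps_eq : eps = alpha + beta + gamma.
Proof.
have [d0 n0 c0] := card_single_deletions.
by rewrite -(cond_d fP) (cond_b fP (tt : single_vertex)) !(cond_card0 f_inv fP) //
           delta_eq1 !mulr1.
Qed.

(* If [beta = 0], or if every vertex has weight [1], the recurrence only sees
   the number of vertices. *)
Lemma alpha_eq1 : alpha = 1.
Proof.
have fE s : (beta == 0) || (s == 1) -> s = alpha + beta + gamma ->
    forall G, f G = s ^+ #|G|.
  move=> bs sE; apply: (recurrence_unique f_inv fP (F := fun G => s ^+ #|G|)).
    by move=> G ->; rewrite delta_eq1.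
  move=> G v; rewrite -(card_del_vertex v).
  have -> : #|contract_vertex v| = #|del_vertex v|.
    by apply: succn_inj; rewrite card_contract_vertex.
  (* For [beta = 0] each vertex costs the factor [alpha + gamma = s]; for [s = 1] the coefficients
     sum to [1], so the constant [1] satisfies (b). *)
  case/orP: bs => /eqP e; first by rewrite exprS {1}sE e; ring.
  by rewrite e !expr1n !mulr1 -sE e.
(* This is the difference of the two evaluations of [path3]; their terms [gamma * k2] cancel. *)
have /eqP : beta * (eps - 1) * (alpha - 1) = 0.
  have := path3_end f_inv fP; rewrite (path3_middle f_inv fP) => /eqP.
  by rewrite -subr_eq0 => /eqP <-; rewrite delta_eq1 eps_eq; ring.
rewrite !mulf_eq0 !subr_eq0 => /orP[bs|/eqP //].
by case: (@not_proper_card (fun n => eps ^+ n)); apply: fE eps_eq.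
Qed.

End ProperInvariant.

(** * Conditions (a)-(d), properness and the link to [Q] for [Upoly] *)

Section UpolyConditions.

Lemma Upoly_conditions (S : comNzRingType) (b c : S) :
  satisfies_conditions 1 b c 1 (1 + b + c) (Upoly b c).
Proof.
split.
- by move=> G G1 G2 /(Upoly_iso b c) ->; apply: Upoly_disjoint_union.
- by move=> G v; rewrite mul1r; apply: Upoly_recurrence.
- exact: Upoly_null.
- rewrite (Upoly_recurrence b c (tt : single_vertex)).
  have U1 (H : graph) : #|H| = 0%N -> Upoly b c H = 1.
    by move=> /graph_iso_null /(Upoly_iso b c) ->; apply: Upoly_null.
  have [d0 n0 c0] := card_single_deletions.
  by rewrite !U1 ?mulr1.
Qed.

(** On two vertices, the edgeless graph has value [(1 + b + c) ^+ 2] and the complete one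
    [(1 + c) * (1 + b + c) + b]; they differ by [b * (b + c)]. *)
Lemma Upoly_proper (S : comNzRingType) (b c : S) :
  b * (b + c) != 0 -> proper_invariant (Upoly b c).
Proof.
move=> nz; exists edgeless2, complete2; split=> //.
rewrite (cond_edgeless2 (@Upoly_iso _ b c) (Upoly_conditions b c)) ?card_bool //.
rewrite (cond_complete2 (@Upoly_iso _ b c) (Upoly_conditions b c)) ?card_bool //.
move=> /eqP; rewrite -subr_eq0; apply/negP; congr (_ != 0): nz; ring.
Qed.

Lemma Upoly_Q (F : fieldType) (b c : F) (G : graph) :
  c != 0 -> Upoly b c G = Q G c (b / c + 1).
Proof.
move=> c0; apply: eq_bigr => X _; rewrite /weight card_induced.
have le := components_le (induced X); rewrite card_induced in le.
(* Of the [#|X|] factors [c], one per component is absorbed through [c * (b / c + 1) = b + c]. *)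
rewrite -[in RHS](subnK le) exprD -mulrA -exprMn; congr (_ * _ ^+ _).
by field.
Qed.

(** Here [b + c] becomes [x * (y - 1) + x = x * y], so the identity needs no division. *)
Lemma Q_Upoly (S : comNzRingType) (x y : S) (G : graph) :
  Q G x y = Upoly (x * (y - 1)) x G.
Proof.
apply: eq_bigr => X _; rewrite /weight card_induced.
have le := components_le (induced X); rewrite card_induced in le.
rewrite -[in LHS](subnK le) exprD -mulrA -exprMn; congr (_ * _ ^+ _); ring.
Qed.

(** Used for the substitution of polynomials and for the embedding into the fraction field. *)
Lemma rmorph_Upoly (S T : comNzRingType) (phi : {rmorphism S -> T}) (b c : S)
    (G : graph) : phi (Upoly b c G) = Upoly (phi b) (phi c) G.
Proof.
rewrite rmorph_sum; apply: eq_bigr => X _.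
by rewrite /weight rmorphM !rmorphXn rmorphD.
Qed.

End UpolyConditions.

Theorem theorem5p10 (R : idomainType) (charR0 : [pchar R] =i pred0) :
  (forall (alpha beta gamma delta eps : R) (f : graph -> R),
     graph_invariant f ->
     proper_invariant f ->
     well_defined_by alpha beta gamma delta eps f ->
     [/\ alpha = 1, delta = 1 & eps = 1 + beta + gamma])
  /\
  (let beta := var0 R in
   let gamma := var1 R in
   let x := var0 R in
   let y := var1 R in
   exists U : graph -> {mpoly R[2]},
     [/\ graph_invariant U,
         proper_invariant U,
         well_defined_by 1 beta gamma 1 (1 + beta + gamma) U,
         (forall (alpha delta eps : {mpoly R[2]}) (U' : graph -> {mpoly R[2]}),
            graph_invariant U' ->
            proper_invariant U' ->
            well_defined_by alpha beta gamma delta eps U' ->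
            forall G : graph, U' G = U G)
       & forall G : graph,
           Q G x y = comp_mpoly [tuple x * (y - 1); x] (U G) /\
           tofrac (U G) =
             Q G (tofrac gamma) (tofrac beta / tofrac gamma + 1)]).
Proof.
(* Stated for any domain: it is applied to [R] and, for uniqueness, to [{mpoly R[2]}]. *)
have params (D : idomainType) (alpha beta gamma delta eps : D) f :
    graph_invariant f -> proper_invariant f ->
    satisfies_conditions alpha beta gamma delta eps f ->
    [/\ alpha = 1, delta = 1 & eps = 1 + beta + gamma].
  move=> f_inv f_pr fP; have a1 := alpha_eq1 f_inv f_pr fP.
  by split; rewrite ?(delta_eq1 f_pr fP) // (eps_eq f_inv f_pr fP) a1.
split=> [alpha beta gamma delta eps f f_inv f_pr [fP _]|beta gamma x y].
  exact: params fP.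
have X_neq0 (i : 'I_2) : 'X_i != 0 :> {mpoly R[2]}.
  apply/eqP=> /(congr1 (meval (fun _ => 1))); rewrite mevalXU meval0.
  by apply/eqP; rewrite oner_eq0.
have U_pr : proper_invariant (Upoly beta gamma).
  apply: Upoly_proper; rewrite mulf_neq0 ?X_neq0 //.
  (* At the point [(1, 0)] the sum [beta + gamma] takes the value [1]. *)
  apply/eqP=> /(congr1 (meval (fun i => (i == ord0)%:R))).
  rewrite mevalD !mevalXU meval0 /= addr0.
  by apply/eqP; rewrite oner_eq0.
exists (Upoly beta gamma); split=> //.
- exact: Upoly_iso.
- exact: well_defined (@Upoly_iso _ _ _) (Upoly_conditions _ _).
(* Properness forces the same parameters as for [Upoly], and the recurrence then determines [U']. *)
- move=> alpha delta eps U' U'_inv U'_pr [U'P _].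
  have [a1 d1 e1] := params _ _ _ _ _ _ _ U'_inv U'_pr U'P.
  rewrite {}a1 {}d1 {}e1 in U'P.
  apply: (recurrence_unique U'_inv U'P) => [G|G v].
    exact: (cond_card0 (@Upoly_iso _ _ _) (Upoly_conditions _ _)).
  exact: (cond_b (Upoly_conditions _ _)).
- move=> G; split.
    rewrite Q_Upoly (rmorph_Upoly (comp_mpoly _)).
    by congr (Upoly _ _ G); apply/esym/comp_mpolyXU.
  by rewrite (rmorph_Upoly (@tofrac _)) Upoly_Q // tofrac_eq0 X_neq0.
Qed.
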